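(* Let $n$ be a positive integer, $c\ge2$, and let $G$ be a bipartite $(cn,N/c)$-Ruzsa--Szemerédi graph on $N$ vertices (with $cn$ and $N/c$ integers). Then every red/blue-coloring of the edges of $G$ contains either an induced copy of $K_{1,n}$ all of whose edges are red or an induced copy of $M_n$ all of whose edges are blue.
   Context: $K_{1,n}$ is the star with $n$ edges and $M_n$ is the matching with $n$ edges. An induced copy of $H$ in $G$ is a subgraph $H'\cong H$ of $G$ such that two vertices of $H'$ are adjacent in $H'$ iff they are adjacent in $G$. A graph is an $(a,b)$-Ruzsa--Szemerédi graph if its edge set is the union of $b$ pairwise disjoint induced matchings, each of size $a$. *)

(* Defs.v *)
From HB Require Import structures.
From mathcomp Require Import all_boot all_order all_algebra.

Set Implicit Arguments.
Unset Strict Implicit.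
Unset Printing Implicit Defensive.

Record sgraph := SGraph {
  vert :> finType;
  adj : rel vert;
  adj_sym : symmetric adj;
  adj_irr : irreflexive adj
}.

Definition edges (G : sgraph) : {set {set G}} :=
  [set e | [exists x, exists y, adj x y && (e == [set x; y])]].

Definition bipartite (G : sgraph) : Prop :=
  exists A : {set G}, forall x y : G, adj x y -> (x \in A) != (y \in A).

(* The centre of the star is None. *)
Definition star_adj (n : nat) : rel (option 'I_n) :=
  fun x y => (x == None) (+) (y == None).

Lemma star_sym n : symmetric (@star_adj n).
Proof. by move=> x y; rewrite /star_adj addbC. Qed.

Lemma star_irr n : irreflexive (@star_adj n).
Proof. by move=> x; rewrite /star_adj addbb. Qed.

Definition star (n : nat) : sgraph := SGraph (@star_sym n) (@star_irr n).

(* The i-th edge of the matching joins (i, false) and (i, true). *)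
Definition matching_adj (n : nat) : rel ('I_n * bool) :=
  fun x y => (x.1 == y.1) && (x.2 != y.2).

Lemma matching_sym n : symmetric (@matching_adj n).
Proof. by move=> x y; rewrite /matching_adj eq_sym [x.2 == _]eq_sym. Qed.

Lemma matching_irr n : irreflexive (@matching_adj n).
Proof. by move=> x; rewrite /matching_adj !eqxx. Qed.

Definition matching (n : nat) : sgraph :=
  SGraph (@matching_sym n) (@matching_irr n).

(* Subgraphs of G are given by a vertex set U and an edge set F. *)
Definition is_subgraph (G : sgraph) (U : {set G}) (F : {set {set G}}) : Prop :=
  F \subset edges G /\ (forall e, e \in F -> e \subset U).

Definition is_isomorphic (H G : sgraph) (U : {set G}) (F : {set {set G}})
    : Prop :=
  exists f : H -> G,
    [/\ injective f,
        f @: [set: H] = U &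
        forall x y : H, adj x y = ([set f x; f y] \in F)].

Definition induced_copy (H G : sgraph) (U : {set G}) (F : {set {set G}})
    : Prop :=
  [/\ is_subgraph U F,
      is_isomorphic H U F &
      {in U &, forall x y, ([set x; y] \in F) = adj x y}].

Definition induced_matching (a : nat) (G : sgraph) (F : {set {set G}}) : Prop :=
  exists U : {set G}, induced_copy (matching a) U F.

Definition ruzsa_szemeredi (a b : nat) (G : sgraph) : Prop :=
  exists M : 'I_b -> {set {set G}},
    [/\ edges G = \bigcup_i M i,
        forall i j, i != j -> [disjoint M i & M j] &
        forall i, induced_matching a (M i)].

Inductive color := Red | Blue.

Definition edge_coloring (G : sgraph) := {e : {set G} | e \in edges G} -> color.

Definition mono_induced_copy (H G : sgraph) (col : edge_coloring G) (k : color)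
    : Prop :=
  exists (U : {set G}) (F : {set {set G}}),
    induced_copy H U F /\ (forall e, val e \in F -> col e = k).

(* Main.v *)
(** If one of the induced matchings has [n] blue edges, these form an induced
    blue [M_n].  Otherwise at most [(n - 1) N / c <= (n - 1) N / 2] of the
    [cn * N / c = nN] edges are blue, so that the red degrees sum to at least
    [2nN - (n - 1) N > (n - 1) N] and some vertex has [n] red neighbours; they
    lie on one side of the bipartition, so the red star they span is induced. *)

Require Import Defs.
From mathcomp Require Import all_boot all_order all_algebra.
From mathcomp Require Import zify.

Import Order.TTheory GRing.Theory Num.Theory.

Set Implicit Arguments.
Unset Strict Implicit.
Unset Printing Implicit Defensive.

Local Open Scope nat_scope.

Section Graph.

Variable G : sgraph.
Implicit Types (x y : G) (e : {set G}) (F : {set {set G}}).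

Lemma edgesP e :
  reflect (exists x y, adj x y /\ e = [set x; y]) (e \in edges G).
Proof.
rewrite inE; apply: (iffP existsP) => [[x /existsP[y /andP[xy /eqP->]]]|].
  by exists x, y.
by case=> x [y [xy ->]]; exists x; apply/existsP; exists y; rewrite xy eqxx.
Qed.

Lemma adj_neq x y : adj x y -> x != y.
Proof. by apply: contraTneq => ->; rewrite adj_irr. Qed.

(** An unordered pair comes from only two ordered ones, which [adj_sym] identifies; comparing
    cardinalities rules out [x = y]. *)
Lemma pair_in_edges x y : ([set x; y] \in edges G) = adj x y.
Proof.
apply/edgesP/idP => [[u [v [uv E]]]|xy]; last by exists x, y.
have xy : x != y.
  move: (congr1 (fun e : {set G} => #|e|) E).
  by rewrite !cards2 (adj_neq uv); case: eqP.
have := set21 x y; have := set22 x y; rewrite E !in_set2.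
case/orP=> /eqP Ey /orP[] /eqP Ex; move: xy uv; rewrite Ex Ey ?eqxx //.
by rewrite adj_sym.
Qed.

Lemma card_edge e : e \in edges G -> #|e| = 2.
Proof. by case/edgesP=> x [y [/adj_neq xy ->]]; rewrite cards2 xy. Qed.

(** Double counting of incidences: every edge of [F] at [x] is the image of a neighbour [y] under
    [[set x; y]]. *)
Lemma double_card_edges_le F :
  F \subset edges G ->
  2 * #|F| <= \sum_(x : G) #|[set y | [set x; y] \in F]|.
Proof.
move=> /subsetP sF.
have -> : 2 * #|F| = \sum_(x : G) #|[set e in F | x \in e]|.
  transitivity (\sum_(e in F) \sum_(x in e) 1).
    rewrite mulnC -sum_nat_const; apply: eq_bigr => e /sF/card_edge.
    by rewrite sum1_card.
  rewrite (exchange_big_dep predT) //=; apply: eq_bigr => x _.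
  by rewrite sum1dep_card; apply: eq_card => e; rewrite !inE.
apply: leq_sum => x _.
apply: leq_trans (leq_imset_card (fun y => [set x; y]) _).
apply/subset_leq_card/subsetP => e; rewrite inE => /andP[eF xe].
have /edgesP[u [v [uv E]]] := sF _ eF.
move: xe; rewrite E in_set2 => /orP[] /eqP ->.
  by apply/imsetP; exists v; rewrite // inE -E.
by apply/imsetP; exists u; rewrite 1?setUC // inE setUC -E.
Qed.

(** Take the image of [f] as [U] and all edges of [G] inside it as [F]; since [f] reflects
    adjacency, each of these comes from an edge of [H]. *)
Lemma mono_induced_copy_embedding (H : sgraph) (f : H -> G)
    (col : edge_coloring G) (k : color) :
  injective f -> (forall p q, adj (f p) (f q) = adj p q) ->
  (forall p q d, adj p q -> val d = [set f p; f q] -> col d = k) ->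
  mono_induced_copy H col k.
Proof.
move=> f_inj f_adj f_col; pose U := f @: [set: H].
have inU p : f p \in U by apply: imset_f; rewrite inE.
pose F := [set e in edges G | e \subset U].
have inF x y : x \in U -> y \in U -> ([set x; y] \in F) = adj x y.
  by move=> xU yU; rewrite in_set pair_in_edges subUset !sub1set xU yU !andbT.
exists U, F; split; first split=> //.
- by split=> [|e]; [apply/subsetP => e|]; rewrite inE => /andP[].
- by exists f; split=> // p q; rewrite inF.
move=> d; rewrite inE => /andP[/edgesP[x [y [xy E]]]].
rewrite E subUset !sub1set => /andP[/imsetP[p _ Ep] /imsetP[q _ Eq]].
by apply: (f_col p q); rewrite -?f_adj -?Ep -?Eq.
Qed.

End Graph.

(* Junk value: vertex sets that are not edges count as not red. *)
Definition is_red (G : sgraph) (col : edge_coloring G) (e : {set G}) : bool :=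
  if insub e is Some d then if col d is Red then true else false else false.

Lemma is_red_val (G : sgraph) (col : edge_coloring G) d :
  is_red col (val d) = if col d is Red then true else false.
Proof. by rewrite /is_red valK. Qed.

Definition red_edges (G : sgraph) (col : edge_coloring G) : {set {set G}} :=
  [set e in edges G | is_red col e].

Lemma red_star (G : sgraph) (col : edge_coloring G) (n : nat) (x : G) :
  bipartite G -> n <= #|[set y | [set x; y] \in red_edges col]| ->
  mono_induced_copy (star n) col Red.
Proof.
case=> A hA; set S := [set y | _] => nS.
pose g (i : 'I_n) : G := enum_val (widen_ord nS i).
have gS i : [set x; g i] \in red_edges col.
  by have := enum_valP (widen_ord nS i); rewrite inE.
have g_adj i : adj x (g i).
  by have := gS i; rewrite inE pair_in_edges => /andP[].
have g_inj : injective g by move=> i j /enum_val_inj[] /ord_inj.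
have g_red d i : val d = [set x; g i] -> col d = Red.
  move=> E; have := gS i; rewrite -E inE is_red_val => /andP[_].
  by case: (col d).
pose f (o : star n) : G := if o is Some i then g i else x.
apply: (mono_induced_copy_embedding (f := f)).
- have x_notin i : x <> g i by move=> E; have := g_adj i; rewrite -E adj_irr.
  by move=> [i|] [j|] //= => [/g_inj->|/esym/x_notin|/x_notin].
- move=> [i|] [j|] /=; rewrite /star_adj /= ?adj_irr // ?g_adj //.
    (* Two leaves both lie on the side opposite to [x], so they cannot be adjacent. *)
    apply/negP => /hA; have /hA := g_adj i; have /hA := g_adj j.
    by case: (x \in A) (g i \in A) (g j \in A) => [] [] [].
  by rewrite adj_sym g_adj.
- move=> [i|] [j|] d //= _; last exact: g_red.
  by rewrite setUC; apply: g_red.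
Qed.

(** The non-red edges of [F] are indexed by [J]. Either [n] of them can be selected, or at most
    [n - 1] of the [a] edges fail to be red. *)
Lemma blue_matching_or_many_red (G : sgraph) (col : edge_coloring G)
    (a n : nat) (F : {set {set G}}) :
  induced_matching a F ->
  mono_induced_copy (matching n) col Blue \/ a < #|F :&: red_edges col| + n.
Proof.
case=> U [[/subsetP FE _] [f [f_inj fU f_adj]] FU].
have inU p : f p \in U by rewrite -fU imset_f.
pose edge (i : 'I_a) := [set f (i, false); f (i, true)].
have edgeF i : edge i \in F by rewrite -f_adj /= /matching_adj /= eqxx.
have edge_inj : injective edge.
  move=> i j E; have := set21 (f (i, false)) (f (i, true)).
  by rewrite -/(edge i) E in_set2 => /orP[] /eqP/f_inj[].
pose J := [set i | ~~ is_red col (edge i)].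
case: (leqP n #|J|) => nJ; [left|right].
  pose w (i : 'I_n) : 'I_a := enum_val (widen_ord nJ i).
  have w_inj : injective w by move=> i j /enum_val_inj[] /ord_inj.
  pose g (p : matching n) : G := f (w p.1, p.2).
  apply: (mono_induced_copy_embedding (f := g)).
  - by move=> [i s] [j t] /f_inj[/w_inj-> ->].
  (* A submatching stays induced: adjacency inside [U] is membership in [F], which [f_adj] reads off
     in the abstract matching. *)
  - move=> [i s] [j t]; rewrite /g -FU // -f_adj /= /matching_adj /=.
    by rewrite (inj_eq w_inj).
  - move=> [i s] [j t] d /andP[/= /eqP<- st] E.
    have {}E : val d = edge (w i).
      apply: etrans E _; rewrite /g /edge /=.
      by case: s t st => [] [] // _; rewrite setUC.
    have := enum_valP (widen_ord nJ i); rewrite inE -/(w i) -E is_red_val.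
    by case: (col d).
have : #|~: J| <= #|F :&: red_edges col|.
  rewrite -(card_imset _ edge_inj); apply/subset_leq_card/subsetP => e.
  case/imsetP=> i iJ ->; move: iJ; rewrite in_setC in_set negbK => ri.
  by rewrite in_setI edgeF in_set ri andbT FE.
by have := cardsC J; rewrite card_ord; lia.
Qed.

Lemma sum_card_disjoint_le (T : finType) (b : nat) (M : 'I_b -> {set T})
    (S : {set T}) :
  (forall i j, i != j -> [disjoint M i & M j]) ->
  \sum_i #|M i :&: S| <= #|S|.
Proof.
move=> disM; under eq_bigr do rewrite -sum1_card.
rewrite -partition_disjoint_bigcup => [|i j /disM].
  by rewrite sum1_card; apply/subset_leq_card/bigcupsP => i _; apply: subsetIr.
by move=> d; apply: disjointWl (subsetIl _ _) (disjointWr (subsetIl _ _) d).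
Qed.

(** The division-free core, with [c] eliminated: [a * b] counts the edges, and [2 * b <= #|G|] is
    what remains of [2 <= c]. *)
Lemma rs_dichotomy (G : sgraph) (n a b : nat) (col : edge_coloring G) :
  0 < #|G| -> 0 < n -> a * b = n * #|G| -> 2 * b <= #|G| ->
  bipartite G -> ruzsa_szemeredi a b G ->
  mono_induced_copy (star n) col Red \/ mono_induced_copy (matching n) col Blue.
Proof.
move=> G0 n0 ab b2 bip [M [_ disM indM]].
pose deg x := #|[set y | [set x; y] \in red_edges col]|.
case: (boolP [exists x, n <= deg x]) => [/existsP[x nx]|].
  by left; apply: red_star nx.
rewrite negb_exists => /forallP deg_lt; right.
case: (boolP [forall i, a < #|M i :&: red_edges col| + n]) => [/forallP many|].
  (* With all red degrees and all blue counts at most [n - 1], writing N for [#|G|]: 2nN = 2ab <= 2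
     (red edges) + 2b(n-1) <= N(n-1) + N(n-1) < 2nN. *)
  exfalso.
  have red_le : 2 * #|red_edges col| <= #|G| * n.-1.
    apply: leq_trans (double_card_edges_le _) _.
      by apply/subsetP => e; rewrite inE => /andP[].
    rewrite -sum_nat_const; apply: leq_sum => x _.
    by have := deg_lt x; rewrite /deg; lia.
  have : b * a <= \sum_(i < b) (#|M i :&: red_edges col| + n.-1).
    rewrite -[b in b * a]card_ord -sum_nat_const; apply: leq_sum => i _.
    by have := many i; lia.
  rewrite big_split /= sum_nat_const card_ord => edges_le.
  have {edges_le} edges_le : b * a <= #|red_edges col| + b * n.-1.
    exact: leq_trans edges_le (leq_add (sum_card_disjoint_le _ disM) _).
  have blue_le : 2 * (b * n.-1) <= #|G| * n.-1 by rewrite mulnA leq_mul.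
  (* The strict step of the chain; it rests on [n] and [#|G|] being positive. *)
  have : n.-1 * #|G| < n * #|G| by rewrite ltn_pmul2r ?prednK.
  lia.
rewrite negb_forall => /existsP[i /negP few].
by case: (blue_matching_or_many_red col n (indM i)).
Qed.

Unset Implicit Arguments.
Local Open Scope ring_scope.

Theorem theorem6p4 (R : realFieldType) (c : R) (n N a b : nat) (G : sgraph)
    (hn : (0 < n)%N) (hc : 2 <= c)
    (hN : (0 < N)%N) (hG : #|G| = N)
    (ha : a%:R = c * n%:R) (hb : b%:R = N%:R / c)
    (hbip : bipartite G) (hRS : ruzsa_szemeredi a b G)
    (col : edge_coloring G) :
  mono_induced_copy (star n) col Red \/ mono_induced_copy (matching n) col Blue.
Proof.
subst N.
have c0 : 0 < c by apply: lt_le_trans hc; rewrite ltr0n.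
apply: (rs_dichotomy (a := a) (b := b)) => //.
  apply/eqP; rewrite -(eqr_nat R) !natrM ha hb mulrC mulrA divfK ?lt0r_neq0 //.
  by rewrite mulrC.
(* Regrouped as N * (2 / c), with 2 / c at most 1. *)
by rewrite -(ler_nat R) natrM hb mulrCA ger_pMr ?ltr0n // ler_pdivrMr ?mul1r.
Qed.
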